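(* In the setting of the context (scalar functional $\Psi=\langle\cdot,\psi\rangle_{\mathbb H}$), let $\alpha\in(0,1)$ and for each $N$ let $R_N$ be a statistic (a measurable function of $\mathcal D_N$) such that the interval $$I_N=\big[\hat\Psi_N-R_N,\ \hat\Psi_N+R_N\big]$$ satisfies $\Pi_N^\Psi(I_N\mid\mathcal D_N)=1-\alpha$. Suppose that $\Pi_N^\Psi(\cdot\mid\mathcal D_N)$ satisfies a renormalized Bernstein-von Mises theorem, i.e. there exists some sequence $(\sigma_N)$ in $(0,\infty)$ such that, as $N\to\infty$: (i) $\sigma_N^{-1}(\hat\Psi_N-\Psi\theta_0)$ converges in distribution to $\mathcal N(0,1)$ under the law of the data generated from $\theta_0$; (ii) the image of the random measure $\Pi_N^\Psi(\cdot\mid\mathcal D_N)$ under the map $x\mapsto\sigma_N^{-1}(x-\hat\Psi_N)$ converges weakly to $\mathcal N(0,1)$ in probability, under the law of the data generated from $\theta_0$. Then $$\mathbb P_{\theta_0}^N(\Psi\theta_0\in I_N)\longrightarrow 1-\alpha,\qquad N\to\infty .$$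
   Context: Let $\mathcal X\subset\mathbb R^d$ be a Borel set of positive finite Lebesgue measure. Let $\Theta$ be a dense linear subspace of a separable Hilbert space $\mathbb H$ and $\{\mathcal G_\theta:\theta\in\Theta\}$ a family of real-valued regression functions on $\mathcal X$. Observations: $Y_i=\mathcal G_\theta(X_i)+\varepsilon_i$, $i\le N$, with $X_i$ uniformly distributed on $\mathcal X$, $\varepsilon_i\sim\mathcal N(0,\sigma_0^2)$ with $\sigma_0^2>0$ known, all of $X_1,\varepsilon_1,\dots,X_N,\varepsilon_N$ independent. Write $\mathcal D_N=((X_i,Y_i))_{i\le N}$, and let $\mathbb P^N_{\theta_0}$ be its law when the data are generated from the fixed ground truth $\theta_0\in\Theta$. Fix a nonzero $\psi\in\mathbb H$ and set $\Psi\theta=\langle\theta,\psi\rangle_{\mathbb H}$. The prior $\Pi_N$ is a Gaussian measure on a finite-dimensional space $E_D\subset\Theta$ of dimension $D=D(N)$. The posterior $\Pi_N(\cdot\mid\mathcal D_N)$ is the probability measure on $E_D$ with density proportional to $\theta\mapsto\exp\big(-\tfrac1{2\sigma_0^2}\sum_{i=1}^N(Y_i-\mathcal G_\theta(X_i))^2\big)$ with respect to $\Pi_N$. Set $\Pi_N^\Psi(\cdot\mid\mathcal D_N)=\Pi_N(\cdot\mid\mathcal D_N)\circ\Psi^{-1}$ and $\hat\Psi_N=\int\Psi\theta\,d\Pi_N(\theta\mid\mathcal D_N)$ (the posterior mean). Random probability measures $\mu_N$ on $\mathbb R$ converge weakly in probability to $\mu$ if $d_{\mathrm{BL}}(\mu_N,\mu)\to0$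 in probability, where $d_{\mathrm{BL}}$ is the bounded Lipschitz metric for weak convergence. *)

(* Defs.v *)
From HB Require Import structures.
From mathcomp Require Import all_boot all_order all_algebra.
From mathcomp Require Import sesquilinear.
From mathcomp Require Import all_classical all_reals all_analysis.

Set Implicit Arguments.
Unset Strict Implicit.
Unset Printing Implicit Defensive.

Import Order.TTheory GRing.Theory Num.Theory.
Import numFieldNormedType.Exports.

Local Open Scope classical_set_scope.
Local Open Scope ring_scope.

(* The measures that depend on the data (posterior, image measures, law of the
   data) are given by their values on sets, as is `pushforward` in the library;
   `\int[mu]` accepts such set functions. Under the measurability hypotheses of
   the theorem they are probability measures. *)

Section hilbert.
Context {R : realType}.

(* A real Hilbert space is a complete normed module H with an inner product
   that induces its norm. *)
Definition induces_norm (H : completeNormedModType R)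
    (ip : {dot H for idfun}) : Prop :=
  forall x : H, `|x| ^+ 2 = ip x x.

Definition separable_space (T : topologicalType) : Prop :=
  exists2 S : set T, countable S & dense S.

Definition linear_subspace (H : lmodType R) (S : set H) : Prop :=
  S 0 /\ forall (a : R) (u v : H), S u -> S v -> S (a *: u + v).

Definition subspace_of_dim (H : lmodType R) (k : nat) (E : set H) : Prop :=
  exists2 b : 'I_k -> H,
    (forall c : 'I_k -> R, \sum_i c i *: b i = 0 -> forall i, c i = 0) &
    E = [set x | exists c : 'I_k -> R, x = \sum_i c i *: b i].

End hilbert.

(* T with its Borel sigma-algebra *)
Definition borel (T : ptopologicalType) := g_sigma_algebraType (@open T).

Section probability.
Context {R : realType}.
Local Open Scope ereal_scope.

(* Lebesgue measure on R^d, as the iterated product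
   lebesgue_measure \x (... \x (lebesgue_measure \x \d_[tuple])) *)
Fixpoint lebesgue_tuple (d : nat) : set (d.-tuple R) -> \bar R :=
  match d with
  | 0%N => \d_([tuple] : 0.-tuple R)
  | d'.+1 => pushforward ((@lebesgue_measure R) \x (lebesgue_tuple (d := d')))
               (fun p : R * d'.-tuple R => [tuple of p.1 :: p.2])
  end.

Definition uniform_law (d : nat) (X A : set (d.-tuple R)) : \bar R :=
  lebesgue_tuple (X `&` A) / lebesgue_tuple X.

(* N(m, s^2), with the point mass at m for s = 0: the library's
   `normal_prob m 0` is a different law. *)
Definition gaussian_law (m s : R) : set R -> \bar R :=
  if s == 0%R then \d_m else normal_prob m s.

(* Gaussian law on the Borel sets of H (possibly degenerate, not necessarily
   centred): every <., h> has a normal law. *)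
Definition gaussian_measure (H : completeNormedModType R)
    (ip : {dot H for idfun}) (mu : set (borel H) -> \bar R) : Prop :=
  forall h : H, exists m s : R, forall A : set R, measurable A ->
    pushforward mu (fun x : borel H => ip x h : R) A = gaussian_law m s A.

(* Joint independence of all the variables X_1, e_1, ..., X_n, e_n; the rule
   for subfamilies is the case where the other sets are setT. *)
Definition all_independent d d1 d2 (Omega : measurableType d)
    (T1 : measurableType d1) (T2 : measurableType d2)
    (P : probability Omega R) (n : nat)
    (X : 'I_n -> Omega -> T1) (e : 'I_n -> Omega -> T2) : Prop :=
  forall (A : 'I_n -> set T1) (B : 'I_n -> set T2),
    (forall i, measurable (A i)) -> (forall i, measurable (B i)) ->
    P [set w | forall i, A i (X i w) /\ B i (e i w)] =
    \prod_(i < n) (P (X i @^-1` A i) * P (e i @^-1` B i)).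

Definition weak_cvg (mu : nat -> set R -> \bar R) (nu : set R -> \bar R) :
    Prop :=
  forall f : R -> R, continuous f -> bounded_fun f ->
    (fun n => \int[mu n]_x (f x)%:E) @ \oo --> \int[nu]_x (f x)%:E.

(* The law mu n of the data is evaluated through its outer measure, which is
   mu n itself on measurable sets, so that the definition is meaningful before
   Z n is known to be measurable. *)
Definition cvg_in_prob0 (disp : nat -> measure_display)
    (T : forall n, measurableType (disp n)) (mu : forall n, set (T n) -> \bar R)
    (Z : forall n, T n -> R) : Prop :=
  forall eps : R, (0 < eps)%R ->
    (fun n => mu_ext (mu n) [set z | (eps < `|Z n z|)%R]) @ \oo --> 0.

(* ||f||_oo + Lip(f) <= 1 *)
Definition BL_unit_ball (f : R -> R) : Prop :=
  exists M L : R, [/\ (0 <= M)%R, (0 <= L)%R, (M + L <= 1)%R,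
    (forall x, `|f x| <= M)%R & (forall x y, `|f x - f y| <= L * `|x - y|)%R].

Definition d_BL (mu nu : set R -> \bar R) : R :=
  sup [set `|fine (\int[mu]_x (f x)%:E) - fine (\int[nu]_x (f x)%:E)|%R
      | f in BL_unit_ball].

End probability.

(* The sample space (R^d x R)^N of the data ((X_i, Y_i))_{i < N} *)
Definition data (R : realType) (d N : nat) := N.-tuple (d.-tuple R * R).

Section regression.
Context {R : realType} {d : nat} {H : completeNormedModType R}.
Variables (X : set (d.-tuple R)) (G : H -> d.-tuple R -> R).

(* G t is a function on X: its values outside X are replaced by 0. *)
Definition regfun (t : H) : d.-tuple R -> R := G t \_ X.

Definition observe (Omega : Type) (t : H) (N : nat)
    (x : 'I_N -> Omega -> d.-tuple R) (e : 'I_N -> Omega -> R) (w : Omega) :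
    data R d N :=
  [tuple (x i w, regfun t (x i w) + e i w) | i < N].

Variable sigma0 : R.

Definition likelihood (N : nat) (z : data R d N) (t : H) : R :=
  expR (- (2 * sigma0 ^+ 2)^-1 *
    \sum_(i < N) ((tnth z i).2 - regfun t (tnth z i).1) ^+ 2).

(* Measures on the finite-dimensional space E are measures on the Borel sets of
   H that are concentrated on E. *)
Variables (E : set H) (Pi : set (borel H) -> \bar R).

Definition posterior (N : nat) (z : data R d N) : set (borel H) -> \bar R :=
  fun B => (\int[Pi]_(t in E `&` B) (likelihood z t)%:E /
            \int[Pi]_(t in E) (likelihood z t)%:E)%E.

Variables (ip : {dot H for idfun}) (psi : H).

Definition Psi (t : borel H) : R := ip t psi.

Definition posterior_Psi (N : nat) (z : data R d N) : set R -> \bar R :=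
  pushforward (posterior z) Psi.

Definition posterior_mean (N : nat) (z : data R d N) : R :=
  fine (\int[posterior z]_t (Psi t)%:E).

End regression.

(* Main.v *)
Require Import Defs.
From HB Require Import structures.
From mathcomp Require Import all_boot all_order all_algebra.
From mathcomp Require Import sesquilinear.
From mathcomp Require Import all_classical all_reals all_analysis.
From mathcomp Require Import measurable_realfun.
From mathcomp Require Import ring lra.

(** Write nu = N(0, 1), q for the solution of nu [-q, q] = 1 - alpha,
    S_N = (hatPsi_N - Psi theta0) / sigma_N and rho_N = R_N / sigma_N. The
    interval I_N contains Psi theta0 exactly when |S_N| <= rho_N, and the
    affine map r |-> (r - hatPsi_N) / sigma_N carries I_N to
    [-rho_N, rho_N], which therefore has mass 1 - alpha under the rescaled
    posterior. The claim is then a Slutsky argument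
    ([coverage_of_intervals]).

    - The map t |-> nu [-t, t] is strictly increasing on t >= 0 and Lipschitz
      ([gauss_mass_lt], [gauss_mass_lipschitz]), so that q exists
      ([gauss_quantile]). A probability measure that is close to nu for the
      bounded Lipschitz metric and gives mass 1 - alpha to [-r, r] has r close
      to q ([radius_of_d_BL_close]); hence rho_N tends to q in probability.
    - Up to an event of small probability, |S_N| <= rho_N lies between
      |S_N| <= q - delta and |S_N| <= q + delta. Trapezoidal test functions
      compare the probabilities of these two events with Gaussian integrals,
      by the weak convergence of S_N, and these integrals are within a
      multiple of delta of nu [-q, q].

    This argument speaks of the probability of sets of data, so hatPsi_N has
    to be a measurable function of the data. The functional Psi is continuous
    by polarization ([continuous_ip]), the space that carries the prior is a Borel
    set because the Gram matrix of a basis is invertible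
    ([measurable_subspace]), the likelihood is jointly measurable in the data
    and the parameter ([measurable_likelihood]), and by Tonelli the posterior
    is a probability kernel ([measurable_bayes_prob]), whose mean is
    measurable ([measurable_bayes_mean]). *)

Set Implicit Arguments.
Unset Strict Implicit.
Unset Printing Implicit Defensive.

Import Order.TTheory GRing.Theory Num.Theory.
Import numFieldNormedType.Exports.

Local Open Scope classical_set_scope.
Local Open Scope ring_scope.

(** * The standard normal mass of symmetric intervals *)

Lemma lipschitz_continuous {R : realType} (f : R -> R) (K : R) : 0 <= K ->
  (forall x y, `|f x - f y| <= K * `|x - y|) -> continuous f.
Proof.
move=> K0 fK x; apply/cvgrPdist_le => e e0.
have K1 : 0 < K + 1 by rewrite ltr_wpDl.
near=> y.
apply: (le_trans (fK x y)); apply: (@le_trans _ _ ((K + 1) * `|x - y|)).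
  by rewrite ler_wpM2r// lerDl.
rewrite -ler_pdivlMl// mulrC.
by near: y; apply: cvgr_dist_le; [exact: cvg_id|rewrite divr_gt0].
Unshelve. all: by end_near. Qed.

(** The absolute value makes the function Lipschitz on the whole line, as an
    even function; on t >= 0 it is the mass of [-t, t]. *)
Definition gauss_mass {R : realType} (t : R) : R :=
  fine (normal_prob 0 1 `[- `|t|, `|t|]).

Lemma gauss_massE {R : realType} (t : R) : 0 <= t ->
  normal_prob 0 1 `[- t, t] = (gauss_mass t)%:E.
Proof.
by move=> t0; rewrite /gauss_mass ger0_norm// fineK// fin_num_measure.
Qed.

Lemma gauss_mass_diff {R : realType} (s t : R) : 0 <= s <= t ->
  normal_prob 0 1 (`[- t, t] `\` `[- s, s]) = (gauss_mass t - gauss_mass s)%:E.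
Proof.
move=> /andP[s0 st]; have t0 := le_trans s0 st.
have sub : `[- s, s]%classic `<=` `[- t, t]%classic.
  by apply: subset_itv; rewrite bnd_simp// lerN2.
rewrite measureD//=; last by rewrite ltey_eq fin_num_measure.
by rewrite (setIidr sub) !gauss_massE.
Qed.

(** The density is at most its peak, and the two intervals differ by a set of
    length 2 (t - s). *)
Lemma gauss_mass_increment {R : realType} (s t : R) : 0 <= s <= t ->
  gauss_mass t - gauss_mass s <= normal_peak 1 * 2 * (t - s).
Proof.
move=> /[dup] st0 /andP[s0 st]; have t0 := le_trans s0 st.
have sub : `[- s, s]%classic `<=` `[- t, t]%classic.
  by apply: subset_itv; rewrite bnd_simp// lerN2.
have len (r : R) : 0 <= r -> lebesgue_measure `[- r, r]%classic = (2 * r)%:E.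
  move=> r0; rewrite lebesgue_measure_itv/= lte_fin.
  case: ltP => [_|rN]; first by rewrite -EFinB; congr EFin; ring.
  by congr EFin; lra.
rewrite -lee_fin -gauss_mass_diff//.
pose D : set R := `[- t, t] `\` `[- s, s].
apply: (@le_trans _ _ (\int[lebesgue_measure]_(x in D) (normal_peak 1)%:E)%E).
  apply: ge0_le_integral => //=.
  - exact: measurableD.
  - by move=> x _; rewrite lee_fin normal_pdf_ge0.
  - apply/measurable_EFinP/measurable_funTS; exact: measurable_normal_pdf.
  - by move=> x _; rewrite lee_fin normal_pdf_ub.
rewrite integral_cst ?measureD//=; first last.
- exact: measurableD.
- by rewrite len// ltry.
rewrite (setIidr sub) !len// -EFinB -EFinM lee_fin.
by rewrite le_eqVlt; apply/orP; left; apply/eqP; ring.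
Qed.

(** The difference of the two intervals contains ]s, t], where the density is
    at least its value at t. *)
Lemma gauss_mass_lt {R : realType} (s t : R) : 0 <= s < t ->
  gauss_mass s < gauss_mass t.
Proof.
move=> /andP[s0 st]; have t0 := le_trans s0 (ltW st).
rewrite -subr_gt0 -lte_fin -gauss_mass_diff ?s0 ?ltW//.
apply: (@lt_le_trans _ _ (normal_prob 0 1 `]s, t])); last first.
  apply: le_measure; rewrite ?inE//=; first exact: measurableD.
  move=> x /=; rewrite !in_itv/= => /andP[sx xt]; split.
    by rewrite xt andbT; lra.
  by move=> /andP[_]; rewrite leNgt sx.
pose c : R := normal_peak 1 * expR (- t ^+ 2 / 2).
have c0 : 0 < c by rewrite mulr_gt0 ?expR_gt0 ?normal_peak_gt0.
apply: (@lt_le_trans _ _ (\int[lebesgue_measure]_(x in `]s, t]) c%:E)%E).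
  rewrite integral_cst//= lebesgue_measure_itv/= lte_fin st -EFinB -EFinM.
  by rewrite lte_fin mulr_gt0// subr_gt0.
apply: ge0_le_integral => //=.
- by move=> x _; rewrite lee_fin ltW.
- apply/measurable_EFinP/measurable_funTS; exact: measurable_normal_pdf.
- move=> x; rewrite in_itv/= => /andP[sx xt].
  rewrite lee_fin normal_pdfE// ler_pM2l ?normal_peak_gt0//.
  rewrite /normal_fun ler_expR subr0 expr1n !mulNr lerN2 mulr2n.
  by rewrite -(natrD _ 1 1) ler_pM2r ?invr_gt0// ler_sqr ?nnegrE//; lra.
Qed.

Lemma gauss_mass_lipschitz {R : realType} (s t : R) :
  `|gauss_mass t - gauss_mass s| <= normal_peak 1 * 2 * `|t - s|.
Proof.
have gN (r : R) : gauss_mass r = gauss_mass `|r|.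
  by rewrite /gauss_mass normr_id.
wlog st : s t / `|s| <= `|t|.
  move=> H; have [/H//|/ltW/H] := lerP `|s| `|t|.
  by rewrite distrC (distrC s).
have st0 : 0 <= `|s| <= `|t| by rewrite normr_ge0.
have le : gauss_mass s <= gauss_mass t.
  rewrite (gN s) (gN t); move: st; rewrite le_eqVlt => /orP[/eqP->//|st].
  by rewrite ltW// gauss_mass_lt// normr_ge0.
rewrite [leLHS]ger0_norm ?subr_ge0// (gN s) (gN t).
apply: (le_trans (gauss_mass_increment st0)).
rewrite ler_wpM2l ?mulr_ge0 ?normal_peak_ge0//.
by have := ler_dist_dist t s; apply: le_trans; rewrite ler_norm.
Qed.

Lemma continuous_gauss_mass {R : realType} : continuous (@gauss_mass R).
Proof.
apply: (@lipschitz_continuous _ _ (normal_peak 1 * 2)).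
  by rewrite mulr_ge0 ?normal_peak_ge0.
by move=> x y; exact: gauss_mass_lipschitz.
Qed.

Lemma gauss_mass0 {R : realType} : gauss_mass (0 : R) = 0.
Proof.
rewrite /gauss_mass normr0 oppr0 set_itv1.
rewrite [X in fine X]null_set_integral//=; last exact: lebesgue_measure_set1.
apply/measurable_EFinP/measurable_funTS; exact: measurable_normal_pdf.
Qed.

Lemma gauss_mass_cvg1 {R : realType} :
  gauss_mass (n%:R : R) @[n --> \oo] --> (1 : R).
Proof.
have : normal_prob 0 1 (`[- n%:R, n%:R]%classic : set R) @[n --> \oo] -->
    normal_prob 0 1 (\bigcup_n (`[- n%:R, n%:R]%classic : set R)).
  apply: nondecreasing_cvg_mu => //=; first exact: bigcupT_measurable.
  move=> m n mn; apply/subsetPset/subset_itv; rewrite bnd_simp ?lerN2 ler_nat//.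
have -> : \bigcup_n (`[- n%:R, n%:R]%classic : set R) = setT.
  apply/seteqP; split=> // x _.
  exists (Num.truncn `|x|).+1 => //=; rewrite in_itv/= -ler_norml.
  by rewrite ltW// truncnS_gt.
rewrite probability_setT => /fine_cvg; apply: cvg_trans.
apply: near_eq_cvg; near=> n.
by rewrite /gauss_mass ger0_norm.
Unshelve. all: by end_near. Qed.

(** Intermediate value theorem, between the mass 0 at t = 0 and masses that
    tend to 1. *)
Lemma gauss_quantile {R : realType} (p : R) : 0 < p < 1 ->
  exists2 q, 0 < q & gauss_mass q = p.
Proof.
move=> /andP[p0 p1].
have [n pn] : exists n, p < gauss_mass (n%:R : R).
  have [n _ Hn] := cvgr_gt _ (@gauss_mass_cvg1 R) _ p1.
  by exists n; exact: (Hn n (leqnn _)).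
have [||q qn gq] := @IVT R gauss_mass 0 n%:R p (ler0n _ _).
- exact/continuous_subspaceT/continuous_gauss_mass.
- rewrite gauss_mass0 ge_min (ltW p0)/= le_max (ltW pn) orbT//.
exists q => //; move: qn; rewrite in_itv/= le_eqVlt => /andP[/orP[/eqP q0|//] _].
by move: p0; rewrite -gq -q0 gauss_mass0 ltxx.
Qed.

(** [normal_prob 0 1] is declared on the sigma-algebra that bears the name of
    its generating half-open intervals. The instances below read the same set
    function as a law on the measurable type R, on which the image measures
    of the posterior live. *)
Section standard_normal.
Context {R : realType}.

Let N01 : set R -> \bar R := normal_prob 0 1.

Let N01_measure0 : N01 set0 = 0%E.
Proof. exact: (measure0 (normal_prob (0 : R) 1)). Qed.

Let N01_ge0 A : (0 <= N01 A)%E.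
Proof. exact: (measure_ge0 (normal_prob (0 : R) 1)). Qed.

Let N01_sigma_additive : semi_sigma_additive N01.
Proof. exact: (@measure_semi_sigma_additive _ _ _ (normal_prob (0 : R) 1)). Qed.

HB.instance Definition _ := isMeasure.Build _ R R N01
  N01_measure0 N01_ge0 N01_sigma_additive.

Let N01_setT : N01 setT = 1%E.
Proof. exact: (@probability_setT _ _ _ (normal_prob (0 : R) 1)). Qed.

HB.instance Definition _ := Measure_isProbability.Build _ R R N01 N01_setT.

Definition std_normal : probability R R := N01.

End standard_normal.

(** * Trapezoidal test functions and the bounded Lipschitz metric *)

(** For a < b, the Lipschitz function that is 1 on [-a, a], 0 outside [-b, b]
    and affine in between. It replaces indicators of intervals, which neither
    weak convergence nor the bounded Lipschitz metric can test. *)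
Definition trapezoid {R : realType} (a b x : R) : R :=
  Num.min 1 (Num.max 0 ((b - `|x|) / (b - a))).

Lemma trapezoid_ge0 {R : realType} (a b x : R) : 0 <= trapezoid a b x.
Proof. by rewrite /trapezoid le_min ler01 le_max lexx. Qed.

Lemma trapezoid_le1 {R : realType} (a b x : R) : trapezoid a b x <= 1.
Proof. by rewrite /trapezoid ge_min lexx. Qed.

Lemma trapezoid_eq1 {R : realType} (a b x : R) : a < b -> `|x| <= a ->
  trapezoid a b x = 1.
Proof.
move=> ab xa; apply/min_idPl; rewrite le_max; apply/orP; right.
by rewrite ler_pdivlMr ?subr_gt0// mul1r lerD2l lerN2.
Qed.

Lemma trapezoid_eq0 {R : realType} (a b x : R) : a < b -> b < `|x| ->
  trapezoid a b x = 0.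
Proof.
move=> ab bx; rewrite /trapezoid (_ : Num.max _ _ = 0).
  by apply/min_idPr.
apply/max_idPl; rewrite ler_pdivrMr ?subr_gt0// mul0r subr_le0; exact: ltW.
Qed.

Lemma trapezoid_lipschitz {R : realType} (a b : R) : a < b -> forall x y,
  `|trapezoid a b x - trapezoid a b y| <= (b - a)^-1 * `|x - y|.
Proof.
move=> ab x y.
(* Clamping to [0, 1] is a contraction. *)
have clamp (u v : R) : `|Num.min 1 (Num.max 0 u) - Num.min 1 (Num.max 0 v)|
    <= `|u - v|.
  wlog uv : u v / u <= v.
    move=> H; have /orP[/H//|/H h] := le_total u v.
    by rewrite [leLHS]distrC [leRHS]distrC.
  rewrite distrC (distrC u) (ger0_norm (_ : 0 <= v - u)) ?subr_ge0//.
  rewrite ler_norml /Num.min /Num.max.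
  by do !case: ifPn; rewrite -?leNgt; lra.
apply: (le_trans (clamp _ _)).
rewrite -mulrBl normrM [leLHS]mulrC [X in X * _ <= _]ger0_norm; last first.
  by rewrite invr_ge0 subr_ge0 ltW.
apply: ler_wpM2l; first by rewrite invr_ge0 subr_ge0 ltW.
have -> : b - `|x| - (b - `|y|) = `|y| - `|x| by ring.
by rewrite [leRHS]distrC; exact: ler_dist_dist.
Qed.

Lemma measurable_lipschitz {R : realType} (f : R -> R) (K : R) : 0 <= K ->
  (forall x y, `|f x - f y| <= K * `|x - y|) -> measurable_fun setT f.
Proof.
by move=> K0 /(lipschitz_continuous K0); exact: continuous_measurable_fun.
Qed.

Lemma measurable_trapezoid {R : realType} (a b : R) : a < b ->
  measurable_fun setT (trapezoid a b).
Proof.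
move=> ab; apply: measurable_lipschitz (trapezoid_lipschitz ab).
by rewrite invr_ge0 subr_ge0 ltW.
Qed.

Lemma integral_norm_le1 d {T : measurableType d} {R : realType}
    (mu : probability T R) (f : T -> R) : measurable_fun setT f ->
  (forall x, `|f x| <= 1) -> (\int[mu]_x (f x)%:E)%E \is a fin_num /\
    `|fine (\int[mu]_x (f x)%:E)| <= 1.
Proof.
move=> mf f1.
have le1 : (`|\int[mu]_x (f x)%:E| <= 1)%E.
  apply: (@le_trans _ _ (\int[mu]_x `|(f x)%:E|)%E).
    by apply: le_abse_integral => //; exact/measurable_EFinP.
  apply: (@le_trans _ _ (\int[mu]_x (cst 1%E x))%E).
    apply: ge0_le_integral => //=.
    - by apply/measurable_EFinP; exact: measurableT_comp.
    - by move=> x _; rewrite lee_fin.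
  by rewrite integral_cst// mul1e probability_le1.
have fn : (\int[mu]_x (f x)%:E)%E \is a fin_num.
  by rewrite fin_num_abs; apply: le_lt_trans le1 (ltry _).
by split=> //; rewrite -lee_fin -abse_EFin fineK.
Qed.

Lemma integrable_norm_le1 d {T : measurableType d} {R : realType}
    (mu : probability T R) (f : T -> R) : measurable_fun setT f ->
  (forall x, `|f x| <= 1) -> mu.-integrable setT (EFin \o f).
Proof.
move=> mf f1; apply: measurable_bounded_integrable => //.
  by apply: le_lt_trans (probability_le1 _ _) (ltry _).
exists 1; split=> // y y1 x _ /=; exact: le_trans (f1 x) (ltW y1).
Qed.

Lemma trapezoid_sandwich {R : realType} (mu : probability R R) (a b : R) :
  a < b ->
  fine (mu `[- a, a]%classic) <= fine (\int[mu]_x (trapezoid a b x)%:E)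
  <= fine (mu `[- b, b]%classic).
Proof.
move=> ab; have mt := measurable_trapezoid ab.
have [tf _] : (\int[mu]_x (trapezoid a b x)%:E)%E \is a fin_num /\
    `|fine (\int[mu]_x (trapezoid a b x)%:E)| <= 1.
  apply: integral_norm_le1 => // x.
  by rewrite ger0_norm ?trapezoid_ge0 ?trapezoid_le1.
apply/andP; split; apply: fine_le; rewrite ?fin_num_measure//.
- rewrite -[X in (mu X <= _)%E]setIT -integral_indic//.
  apply: ge0_le_integral => //=.
  - by apply/measurable_EFinP; exact: measurable_indic.
  - exact/measurable_EFinP.
  - move=> x _; rewrite lee_fin indicE; case: (boolP (x \in _)) => [|_].
      by rewrite inE/= in_itv/= -ler_norml => xa; rewrite trapezoid_eq1.
    exact: trapezoid_ge0.
- rewrite -[X in (_ <= mu X)%E]setIT -integral_indic//.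
  apply: ge0_le_integral => //=.
  - by move=> x _; rewrite lee_fin trapezoid_ge0.
  - exact/measurable_EFinP.
  - by apply/measurable_EFinP; exact: measurable_indic.
  - move=> x _; rewrite lee_fin indicE; case: (boolP (x \in _)) => [_|].
      exact: trapezoid_le1.
    rewrite notin_setE/= in_itv/= -ler_norml => /negP; rewrite -ltNge => bx.
    by rewrite trapezoid_eq0.
Qed.

(** The function f / (1 + K) belongs to the bounded Lipschitz unit ball. *)
Lemma d_BL_lipschitz {R : realType} (mu nu : probability R R) (f : R -> R)
    (K : R) : 0 <= K -> (forall x, `|f x| <= 1) ->
  (forall x y, `|f x - f y| <= K * `|x - y|) ->
  `|fine (\int[mu]_x (f x)%:E) - fine (\int[nu]_x (f x)%:E)|
  <= (1 + K) * d_BL mu nu.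
Proof.
move=> K0 f1 fK; have mf := measurable_lipschitz K0 fK.
have K1 : 0 < 1 + K by rewrite ltr_pwDl.
rewrite -ler_pdivrMl//.
have scale (m : probability R R) :
    fine (\int[m]_x ((1 + K)^-1 * f x)%:E) =
    (1 + K)^-1 * fine (\int[m]_x (f x)%:E).
  under eq_integral do rewrite EFinM.
  rewrite integralZl//=; last exact: integrable_norm_le1.
  by rewrite fineM//; exact: (integral_norm_le1 m mf f1).1.
rewrite -{1}(gtr0_norm (_ : 0 < (1 + K)^-1)) ?invr_gt0// -normrM mulrBr -!scale.
apply: ub_le_sup.
  exists 2 => _ [g [M [L [M0 L0 ML gM gL]]] <-].
  have mg := measurable_lipschitz L0 gL.
  have g1 y : `|g y| <= 1 by apply: (le_trans (gM y)); lra.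
  have [_ mu1] := integral_norm_le1 mu mg g1.
  have [_ nu1] := integral_norm_le1 nu mg g1.
  by apply: (le_trans (ler_normB _ _)); rewrite -[2]/(1 + 1) lerD.
exists (fun x => (1 + K)^-1 * f x) => //.
exists (1 + K)^-1, ((1 + K)^-1 * K); split.
- by rewrite invr_ge0 ltW.
- by rewrite mulr_ge0// invr_ge0 ltW.
- by rewrite -{1}[(1 + K)^-1]mulr1 -mulrDr mulVf// gt_eqF.
- move=> x; rewrite normrM gtr0_norm ?invr_gt0//.
  by rewrite ler_piMr// invr_ge0 ltW.
- move=> x y; rewrite -mulrBr normrM gtr0_norm ?invr_gt0// -mulrA.
  by rewrite ler_pM2l ?invr_gt0.
Qed.

(** If r < q - delta, then the mass of [-r, r] under mu is at most the integral
    of the trapezoid between q - delta and q - delta / 2, which exceeds the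
    same integral under the normal law by a small amount at most. The latter
    integral is at most the normal mass of [-(q - delta / 2), q - delta / 2],
    which is less than that of [-q, q] by strict monotonicity. The case
    r > q + delta is symmetric. *)
Lemma radius_of_d_BL_close {R : realType} (q delta : R) : 0 < delta < q ->
  exists2 eta, 0 < eta & forall (mu : probability R R) (r : R),
    mu `[- r, r]%classic = (gauss_mass q)%:E ->
    d_BL mu (std_normal) <= eta -> q - delta <= r <= q + delta.
Proof.
move=> /andP[d0 dq].
(* The trapezoids used below have slope 1 / (delta / 2), so that c is the
   factor with which [d_BL] controls their integrals. *)
pose c := 1 + (delta / 2)^-1.
have c0 : 0 < c by rewrite ltr_pwDl// invr_ge0 divr_ge0 ?ltW.
have lo : 0 < gauss_mass q - gauss_mass (q - delta / 2).
  by rewrite subr_gt0 gauss_mass_lt//; lra.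
have hi : 0 < gauss_mass (q + delta / 2) - gauss_mass q.
  by rewrite subr_gt0 gauss_mass_lt//; lra.
pose m := Num.min (gauss_mass q - gauss_mass (q - delta / 2))
                  (gauss_mass (q + delta / 2) - gauss_mass q).
have m0 : 0 < m by rewrite lt_min lo.
exists (c^-1 * (m / 2)) => [|mu r mur dBL].
  by rewrite mulr_gt0 ?invr_gt0// divr_gt0.
have close a b : b - a = delta / 2 ->
    `|fine (\int[mu]_x (trapezoid a b x)%:E) -
      fine (\int[std_normal]_x (trapezoid a b x)%:E)| < m.
  move=> ba; have ab : a < b by rewrite -subr_gt0 ba divr_gt0.
  apply: (@le_lt_trans _ _ (m / 2)); last by lra.
  apply: le_trans (@d_BL_lipschitz _ mu (std_normal) _ (b - a)^-1 _ _ _) _.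
  - by rewrite invr_ge0 subr_ge0 ltW.
  - by move=> x; rewrite ger0_norm ?trapezoid_ge0 ?trapezoid_le1.
  - exact: trapezoid_lipschitz.
  - by rewrite ba -/c -ler_pdivlMl.
have gmE t : 0 <= t -> fine (std_normal `[- t, t]%classic) = gauss_mass t.
  by move=> t0; rewrite [std_normal _]gauss_massE.
have sub a b : a <= b -> fine (mu `[- a, a]%classic) <= fine (mu `[- b, b]%classic).
  move=> ab; rewrite fine_le ?fin_num_measure// le_measure ?inE//.
  by apply: subset_itv; rewrite bnd_simp// lerN2.
have mE : fine (mu `[- r, r]%classic) = gauss_mass q by rewrite mur.
have [ml mh] : m <= gauss_mass q - gauss_mass (q - delta / 2) /\
    m <= gauss_mass (q + delta / 2) - gauss_mass q.
  by rewrite /m !ge_min !lexx orbT.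
apply/andP; split; rewrite leNgt; apply/negP => rq.
- have ab : q - delta < q - delta / 2 by lra.
  have /andP[s1 _] := trapezoid_sandwich mu ab.
  have /andP[_ s2] := trapezoid_sandwich (std_normal) ab.
  have := close (q - delta) (q - delta / 2).
  rewrite ltr_norml => /(_ _)/andP[|_ H]; first by lra.
  have := sub _ _ (ltW rq); rewrite mE => s3.
  rewrite gmE in s2; last by lra.
  by move: s1 s2 s3 H ml; clear; lra.
- have ab : q + delta / 2 < q + delta by lra.
  have /andP[_ s1] := trapezoid_sandwich mu ab.
  have /andP[s2 _] := trapezoid_sandwich (std_normal) ab.
  have := close (q + delta / 2) (q + delta).
  rewrite ltr_norml => /(_ _)/andP[|H _]; first by lra.
  have := sub _ _ (ltW rq); rewrite mE => s3.
  rewrite gmE in s2; last by lra.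
  by move: s1 s2 s3 H mh; clear; lra.
Qed.

(** * Coverage of intervals with random radii *)

(** The image of a probability under a function, given with a proof of its
    measurability, so that it is a probability by construction while remaining
    convertible to [pushforward]. *)
Definition image_prob d d' {T : measurableType d} {T' : measurableType d'}
    {R : realType} (P : probability T R) (f : T -> T')
    (mf : measurable_fun setT f) : probability T' R :=
  distribution P (HB.pack f (isMeasurableFun.Build _ _ _ _ _ mf) : {mfun T >-> T'}).

(** On measurable sets the outer measure is the measure itself; this turns a
    bound on the outer measure of the event that two laws are far apart into
    one for measurable events that imply it almost surely. *)
Lemma le_mu_ext_negligible d {T : measurableType d} {R : realType}
    (Q : probability T R) (A B N : set T) : measurable A -> Q.-negligible N ->
  A `<=` N `|` B -> (Q A <= mu_ext Q B)%E.
Proof.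
move=> mA [N' [mN' QN' NN']] AB.
have mAN : measurable (A `\` N') by exact: measurableD.
have -> : Q A = Q (A `\` N').
  rewrite measureD//; last by rewrite ltey_eq fin_num_measure.
  rewrite [X in (_ - X)%E](_ : _ = 0%E) ?sube0//.
  apply/eqP; rewrite eq_le measure_ge0 andbT -QN' le_measure ?inE//.
  exact: measurableI.
rewrite -measurable_mu_extE//; apply: le_mu_ext => x [/AB[/NN'|//]].
by [].
Qed.

Lemma weak_cvg_test {R : realType} (nu : nat -> probability R R)
    (mu : probability R R) (f : R -> R) : weak_cvg nu mu -> continuous f ->
  (forall x, `|f x| <= 1) ->
  (fun n => fine (\int[nu n]_x (f x)%:E)) @ \oo --> fine (\int[mu]_x (f x)%:E).
Proof.
move=> cnu cf f1.
have mf : measurable_fun setT f by exact: continuous_measurable_fun.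
apply: fine_cvg; rewrite fineK; last exact: (integral_norm_le1 mu mf f1).1.
apply: cnu => //.
by exists 1; split => // y y1 x _ /=; exact: le_trans (f1 x) (ltW y1).
Qed.

(** Slutsky's argument for intervals with random radii: rho n tends in
    probability to the number q for which [-q, q] has normal mass p, since
    [-rho, rho] has mass p under laws that approach the normal law. So the
    event |S n| <= rho n is squeezed between the events |S n| <= q - delta
    and |S n| <= q + delta. *)
Lemma coverage_of_intervals {R : realType} (disp : nat -> measure_display)
    (T : forall n, measurableType (disp n)) (Q : forall n, probability (T n) R)
    (S rho : forall n, T n -> R) (mu : forall n, T n -> probability R R)
    (p : R) : 0 < p < 1 ->
  (forall n, measurable_fun setT (S n)) ->
  (forall n, measurable_fun setT (rho n)) ->
  weak_cvg (fun n => pushforward (Q n) (S n)) (normal_prob 0 1) ->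
  (forall n, {ae Q n, forall z, mu n z `[- rho n z, rho n z]%classic = p%:E}) ->
  cvg_in_prob0 (fun n => Q n : set (T n) -> \bar R)
    (fun n z => d_BL (mu n z) (normal_prob 0 1)) ->
  (fun n => Q n [set z | `|S n z| <= rho n z]) @ \oo --> p%:E.
Proof.
move=> p01 mS mrho cS aemu cmu.
have [q q0 gq] := gauss_quantile p01.
pose nu n := image_prob (Q n) (mS n).
have mE n : measurable [set z | `|S n z| <= rho n z].
  rewrite -[X in measurable X]setTI.
  by apply: measurable_fun_le => //; exact: measurableT_comp.
have nuE n (a : R) : nu n `[- a, a]%classic = Q n [set z | `|S n z| <= a].
  rewrite -[LHS]/(Q n (S n @^-1` _)); congr (Q n _).
  by apply/seteqP; split=> z /=; rewrite in_itv/= -ler_norml.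
have mSle n (a : R) : measurable [set z | `|S n z| <= a].
  rewrite -[X in measurable X]setTI.
  by apply: measurable_fun_le => //; exact: measurableT_comp.
have gauss_mass_test (a b : R) : a < b -> 0 <= a ->
    gauss_mass a <= fine (\int[std_normal]_x (trapezoid a b x)%:E) <= gauss_mass b.
  move=> ab a0; have := trapezoid_sandwich std_normal ab.
  by rewrite ![std_normal _]gauss_massE// (le_trans a0 (ltW ab)).
apply/fine_cvgP; split; first by apply: nearW => n; rewrite fin_num_measure.
apply/cvgrPdist_le => eps eps0.
pose K : R := normal_peak 1 * 2.
have K0 : 0 <= K by rewrite mulr_ge0 ?normal_peak_ge0.
(* The first bound keeps q - 2 delta positive. By the second one, moving q by
   2 delta changes the Gaussian mass by at most eps / 2; the rest of eps pays
   for weak convergence and for the bad event, eps / 4 each. *)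
pose delta := Num.min (q / 4) (eps / 4 / (K + 1)).
have d0 : 0 < delta.
  by rewrite lt_min !divr_gt0// ltr_wpDl.
have [dq dK] : delta <= q / 4 /\ delta <= eps / 4 / (K + 1).
  by rewrite !ge_min !lexx orbT.
have Kd : K * (2 * delta) <= eps / 2.
  apply: (@le_trans _ _ ((K + 1) * (2 * delta))).
    by rewrite ler_wpM2r ?lerDl// mulr_ge0// ltW.
  move: dK; rewrite ler_pdivlMr ?ltr_wpDl//; lra.
have hi : gauss_mass (q + 2 * delta) <= p + eps / 2.
  have := @gauss_mass_increment R q (q + 2 * delta).
  rewrite gq -/K => /(_ _)/le_trans => H.
  have : gauss_mass (q + 2 * delta) - p <= eps / 2.
    by apply: H; [lra|apply: le_trans Kd; rewrite addrAC subrr add0r].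
  by lra.
have lo : p - eps / 2 <= gauss_mass (q - 2 * delta).
  have := @gauss_mass_increment R (q - 2 * delta) q.
  rewrite gq -/K => /(_ _)/le_trans => H.
  have : p - gauss_mass (q - 2 * delta) <= eps / 2.
    apply: H; first by lra.
    by apply: le_trans Kd; rewrite ler_wpM2l//; lra.
  by lra.
have [|eta eta0 close] := @radius_of_d_BL_close R q delta; first by lra.
have trap1 a b x : `|@trapezoid R a b x| <= 1.
  by rewrite ger0_norm ?trapezoid_ge0 ?trapezoid_le1.
have ctrap a b : a < b -> continuous (@trapezoid R a b).
  move=> ab; apply: lipschitz_continuous (trapezoid_lipschitz ab).
  by rewrite invr_ge0 subr_ge0 ltW.
have abhi : q + delta < q + 2 * delta by lra.
have ablo : q - 2 * delta < q - delta by lra.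
have /cvgrPdist_le /(_ (eps / 4)) cvhi :=
  @weak_cvg_test R nu std_normal _ cS (ctrap _ _ abhi) (trap1 _ _).
have /cvgrPdist_le /(_ (eps / 4)) cvlo :=
  @weak_cvg_test R nu std_normal _ cS (ctrap _ _ ablo) (trap1 _ _).
have /fine_cvgP[fbad /cvgrPdist_le /(_ (eps / 4)) cbad] := cmu _ eta0.
have e4 : 0 < eps / 4 by rewrite divr_gt0.
near=> n.
(* Being defined by rho, the bad event is measurable, whereas the event that
   the bounded Lipschitz distance is large need not be. *)
pose bad : set (T n) := ~` (rho n @^-1` `[q - delta, q + delta]).
have mbad : measurable bad.
  by apply: measurableC; rewrite -[X in measurable X]setTI; exact: mrho.
have Qbad : fine (Q n bad) <= eps / 4.
  have fb : mu_ext (Q n) [set z | eta < `|d_BL (mu n z) (normal_prob 0 1)|]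
    \is a fin_num by near: n.
  have : `|0 - fine (mu_ext (Q n)
      [set z | eta < `|d_BL (mu n z) (normal_prob 0 1)|])| <= eps / 4.
    by near: n; exact: cbad.
  rewrite sub0r normrN => /(le_trans (ler_norm _)); apply: le_trans.
  rewrite fine_le ?fin_num_measure//.
  apply: le_mu_ext_negligible (aemu n) _ => // z nz.
  have [H|nH] := pselect (mu n z `[- rho n z, rho n z]%classic = p%:E);
    last by left.
  right => /=; rewrite ltNge; apply/negP => /(le_trans (ler_norm _)) le.
  by apply: nz; rewrite /= in_itv/=; apply: close le; rewrite gq.
have addQ (A B : set (T n)) : measurable A -> measurable B ->
    A `<=` B `|` bad -> fine (Q n A) <= fine (Q n B) + eps / 4.
  move=> mA mB AB; apply: (@le_trans _ _ (fine (Q n B) + fine (Q n bad))).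
    rewrite -lee_fin EFinD !fineK ?fin_num_measure//.
    apply: le_trans (measureU2 _ _ _) => //.
    by rewrite le_measure ?inE//; exact: measurableU.
  by rewrite lerD2l.
have upper : fine (Q n [set z | `|S n z| <= rho n z]) <=
    fine (Q n [set z | `|S n z| <= q + delta]) + eps / 4.
  apply: addQ => // z /= Sz; have [|nb] := pselect (bad z); first by right.
  left; move/contrapT : nb; rewrite /= in_itv/= => /andP[_].
  exact: le_trans.
have lower : fine (Q n [set z | `|S n z| <= q - delta]) <=
    fine (Q n [set z | `|S n z| <= rho n z]) + eps / 4.
  apply: addQ => // z /= Sz; have [|nb] := pselect (bad z); first by right.
  left; move/contrapT : nb; rewrite /= in_itv/= => /andP[+ _].
  exact: le_trans.
have /andP[+ _] := trapezoid_sandwich (nu n) abhi.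
have /andP[_ +] := trapezoid_sandwich (nu n) ablo.
rewrite !nuE => sl sh.
have /andP[_ gh] := gauss_mass_test _ _ abhi (addr_ge0 (ltW q0) (ltW d0)).
have q2d : 0 <= q - 2 * delta by lra.
have /andP[gl _] := gauss_mass_test _ _ ablo q2d.
have : `|fine (\int[std_normal]_x (trapezoid (q + delta) (q + 2 * delta) x)%:E) -
    fine (\int[nu n]_x (trapezoid (q + delta) (q + 2 * delta) x)%:E)| <= eps / 4.
  by near: n; exact: cvhi.
have : `|fine (\int[std_normal]_x (trapezoid (q - 2 * delta) (q - delta) x)%:E) -
    fine (\int[nu n]_x (trapezoid (q - 2 * delta) (q - delta) x)%:E)| <= eps / 4.
  by near: n; exact: cvlo.
rewrite !ler_norml => /andP[_ tl] /andP[th _].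
move: upper lower; rewrite /=; set Qn := fine (Q n _) => upper lower.
by apply/andP; split; lra.
Unshelve. all: by end_near. Qed.

(** * Borel measurability in a Hilbert space *)

(** By polarization the inner product with psi is a combination of squared
    norms. *)
Lemma continuous_ip {R : realType} (H : completeNormedModType R)
    (ip : {dot H for idfun}) (psi : H) : induces_norm ip ->
  continuous (fun x : H => ip x psi).
Proof.
move=> ipn.
have polar x : ip x psi = (`|x + psi| ^+ 2 - `|x| ^+ 2 - `|psi| ^+ 2) / 2.
  by rewrite !ipn hnormD /= expr0 mul1r; field.
rewrite (_ : (fun x => _) =
  (fun x => (`|x + psi| ^+ 2 - `|x| ^+ 2 - `|psi| ^+ 2) / 2)); last first.
  by apply/funext.
move=> x; apply: cvgMl; apply: cvgB; last exact: cvg_cst.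
apply: cvgB.
  apply: (@cvg_comp _ _ _ (fun x : H => `|x + psi|) (fun r : R => r ^+ 2)).
    by apply: cvg_norm; apply: cvgD; [exact: cvg_id|exact: cvg_cst].
  exact: exprn_continuous.
apply: (@cvg_comp _ _ _ (fun x : H => `|x|) (fun r : R => r ^+ 2)).
  by apply: cvg_norm; exact: cvg_id.
exact: exprn_continuous.
Qed.

Lemma continuous_measurable_borel {R : realType} (T : ptopologicalType)
  (f : T -> R) : continuous f -> measurable_fun [set: borel T] (f : borel T -> R).
Proof.
move=> /continuousP cf; apply: (measurability _ (RGenOpens.measurableE R)).
move=> _ [_ [a [b ->] <-]]; rewrite setTI.
by apply: sub_sigma_algebra; apply: cf; exact: interval_open.
Qed.

(** The coordinates of x in E are the inner products of x with the basis,
    multiplied by the inverse of the Gram matrix A. The formula extends to all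
    of H, and E is the set where the continuous function r, the distance from
    x to the vector with these coordinates, vanishes. *)
Lemma measurable_subspace {R : realType} (H : completeNormedModType R)
    (ip : {dot H for idfun}) (k : nat) (E : set H) : induces_norm ip ->
  subspace_of_dim k E -> measurable (E : set (borel H)).
Proof.
move=> ipn [b bfree ->].
pose A : 'M[R]_k := \matrix_(i, j) ip (b i) (b j).
have Aunit : A \in unitmx.
  rewrite -row_free_unit -kermx_eq0; apply/eqP/row_matrixP => i.
  set v := row i _; rewrite row0.
  (* A vector v of the kernel of A gives a vector y orthogonal to the basis,
     hence to itself. *)
  have vA : v *m A = 0 by apply/sub_kermxP; exact: row_sub.
  pose y := \sum_j v 0 j *: b j.
  have yb j : ip y (b j) = 0.
    have := congr1 (fun M : 'rV_k => M 0 j) vA; rewrite !mxE => <-.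
    rewrite /y linear_sumlz /=; apply: eq_bigr => l _.
    by rewrite linearZl_LR /= !mxE.
  have y0 : y = 0.
    apply/eqP; rewrite -normr_eq0 -sqrf_eq0 ipn {2}/y linear_sumr big1// => j _.
    by rewrite linearZr_LR /= yb mulr0.
  by apply/rowP => j; rewrite [RHS]mxE; exact: (bfree (fun j => v 0 j)).
pose co (x : H) : 'rV_k := (\row_j ip x (b j)) *m invmx A.
pose r (x : H) : R := `|x - \sum_i co x 0 i *: b i|.
have cr : continuous r.
  have cco i : continuous (fun x => co x 0 i).
    rewrite (_ : (fun x => co x 0 i) =
        (fun x => \sum_j ip x (b j) * invmx A j i)); last first.
      by apply/funext => x; rewrite mxE; apply: eq_bigr => j _; rewrite mxE.
    move=> x; apply: cvg_big => [|j _]; first exact: add_continuous.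
    apply: cvgMr_tmp.
    exact: continuous_ip.
  move=> x; apply: cvg_norm; apply: cvgB; first exact: cvg_id.
  apply: cvg_big => [|i _]; first exact: add_continuous.
  apply: cvgZr_tmp.
  exact: cco.
have mr := continuous_measurable_borel cr.
rewrite (_ : [set x | _] = r @^-1` [set 0]); last first.
  apply/seteqP; split=> x /=; rewrite /r.
    move=> [c ->]; set y := \sum_i c i *: b i.
    have yb : \row_j ip y (b j) = (\row_j c j) *m A.
      apply/rowP => j; rewrite !mxE /y linear_sumlz/=; apply: eq_bigr => l _.
      by rewrite linearZl_LR/= !mxE.
    rewrite /co yb mulmxK// [X in _ - X](_ : _ = y) ?subrr ?normr0//.
    by apply: eq_bigr => i _; rewrite mxE.
  by move=> /eqP; rewrite normr_eq0 subr_eq0 => /eqP ->; exists (fun i => co x 0 i).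
by rewrite -[X in measurable X]setTI; exact: mr.
Qed.

(** * The posterior as a probability kernel *)

(** The posterior for a prior Pi carried by E and a likelihood L in ]0, 1] that
    is jointly measurable on E. *)
Section bayes.
Context d1 d2 {Z : measurableType d1} {Y : measurableType d2} {R : realType}.
Variables (Pi : probability Y R) (E : set Y) (L : Z -> Y -> R).
Hypotheses (mE : measurable E) (PiE : Pi E = 1%E).
Hypothesis mL : measurable_fun ([set: Z] `*` E) (fun p : Z * Y => L p.1 p.2).
Hypothesis L01 : forall z t, 0 < L z t <= 1.

Let mLz z : measurable_fun E (L z).
Proof.
apply: (measurable_comp _ _ mL (_ : measurable_fun E (pair z))).
- exact: measurableX.
- by move=> _ [t Et <-].
- exact/measurable_funTS/pair1_measurable.
Qed.

(** The evidence is positive because L is positive on E, which carries the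
    prior, so Bayes' formula never divides by 0. *)
Lemma bayes_evidence z : exists2 c, 0 < c &
  (\int[Pi]_(t in E) (L z t)%:E)%E = c%:E.
Proof.
have le1 : (\int[Pi]_(t in E) (L z t)%:E <= 1)%E.
  rewrite -PiE -[leRHS]mul1e -integral_cst//.
  apply: ge0_le_integral => //=.
  - by move=> t _; rewrite lee_fin ltW//; case/andP: (L01 z t).
  - exact/measurable_EFinP.
  - by move=> t _; rewrite lee_fin; case/andP: (L01 z t).
have gt0 : (0 < \int[Pi]_(t in E) (L z t)%:E)%E.
  rewrite lt0e integral_ge0 ?andbT; last first.
    by move=> t _; rewrite lee_fin ltW//; case/andP: (L01 z t).
  apply/eqP => int0.
  have : ae_eq Pi E (fun t => (L z t)%:E) (cst 0%E).
    apply/ae_eq_integral_abs => //; first exact/measurable_EFinP.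
    rewrite -[RHS]int0; apply: eq_integral => t _.
    by rewrite gee0_abs// lee_fin ltW//; case/andP: (L01 z t).
  move=> [N [mN PiN NE]].
  have : (Pi E <= Pi N)%E.
    rewrite le_measure ?inE// => t Et; apply: NE => /(_ Et)/= [] L0.
    by have /andP[] := L01 z t; rewrite L0 ltxx.
  by rewrite PiE PiN leNgt lte01.
exists (fine (\int[Pi]_(t in E) (L z t)%:E)).
  by rewrite fine_gt0// gt0/= (le_lt_trans le1) ?ltry.
by rewrite fineK// ge0_fin_numE ?ltW// (le_lt_trans le1) ?ltry.
Qed.

Definition bayes (z : Z) (B : set Y) : \bar R :=
  (\int[Pi]_(t in E `&` B) (L z t)%:E / \int[Pi]_(t in E) (L z t)%:E)%E.

Lemma bayesE z : exists2 c, 0 < c &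
  forall B, bayes z B = (c%:E * \int[Pi]_(t in E `&` B) (L z t)%:E)%E.
Proof.
have [c c0 cE] := bayes_evidence z; exists c^-1; first by rewrite invr_gt0.
by move=> B; rewrite /bayes cE inver gt_eqF// muleC.
Qed.

Let bayes0 z : bayes z set0 = 0%E.
Proof. by have [c _ ->] := bayesE z; rewrite setI0 integral_set0 mule0. Qed.

Let bayes_ge0 z B : (0 <= bayes z B)%E.
Proof.
have [c c0 ->] := bayesE z; apply: mule_ge0; first by rewrite lee_fin ltW.
by apply: integral_ge0 => t _; rewrite lee_fin ltW//; case/andP: (L01 z t).
Qed.

Let bayes_sigma_additive z : semi_sigma_additive (bayes z).
Proof.
move=> F mF tF mUF.
have -> : bayes z (\bigcup_n F n) = (\sum_(i <oo) bayes z (F i))%E.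
  have [c c0 cE] := bayesE z.
  under eq_eseriesr do rewrite cE.
  rewrite cE nneseriesZl; last first.
    move=> i _; apply: integral_ge0 => t _.
    by rewrite lee_fin ltW//; case/andP: (L01 z t).
  congr (_ * _)%E; rewrite setI_bigcupr ge0_integral_bigcup//.
  - by move=> i; exact: measurableI.
  - apply/measurable_EFinP; apply: measurable_funS (mLz z) => //.
    by move=> t [i _ []].
  - by move=> t _; rewrite lee_fin ltW//; case/andP: (L01 z t).
  - exact: trivIset_setIl.
by apply: is_cvg_nneseries.
Qed.

HB.instance Definition _ z := isMeasure.Build _ Y R (bayes z)
  (bayes0 z) (@bayes_ge0 z) (@bayes_sigma_additive z).

Let bayes_setT z : bayes z setT = 1%E.
Proof.
have [c c0 cE] := bayes_evidence z.
by rewrite /bayes setIT cE inver gt_eqF// -EFinM mulfV// gt_eqF.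
Qed.

HB.instance Definition _ z := Measure_isProbability.Build _ Y R (bayes z)
  (bayes_setT z).

Definition bayes_prob z : probability Y R := bayes z.

(* Tonelli, for the likelihood extended by 0 outside of E `&` B. *)
Let measurable_numerator B : measurable B ->
  measurable_fun setT (fun z => \int[Pi]_(t in E `&` B) (L z t)%:E)%E.
Proof.
move=> mB; pose f : Z * Y -> \bar R :=
  (fun p => (L p.1 p.2)%:E) \_ ([set: Z] `*` (E `&` B)).
have mEB : measurable ([set: Z] `*` (E `&` B)).
  by apply: measurableX => //; exact: measurableI.
have -> : (fun z => \int[Pi]_(t in E `&` B) (L z t)%:E)%E = fubini_F Pi f.
  apply/funext => z; rewrite /fubini_F [LHS]integral_mkcond.
  apply: eq_integral => t _; rewrite /f !patchE.
  congr (if _ then _ else _); apply/idP/idP => /set_mem H; apply/mem_set => //.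
  by case: H.
apply: measurable_fun_fubini_tonelli_F.
  apply/(measurable_restrictT _ mEB)/measurable_EFinP.
  apply: measurable_funS mL; first exact: measurableX.
  by move=> p [_ []].
move=> p; rewrite /f patchE; case: ifP => // _.
by rewrite lee_fin ltW//; case/andP: (L01 p.1 p.2).
Qed.

Lemma measurable_bayes_prob B : measurable B ->
  measurable_fun setT (fun z => bayes_prob z B).
Proof.
move=> mB.
(* The inverse of the evidence is written as a power, a measurable function. *)
have -> : (fun z => bayes_prob z B) = (fun z =>
    (\int[Pi]_(t in E `&` B) (L z t)%:E) *
    (fine (\int[Pi]_(t in E `&` setT) (L z t)%:E) `^ (-1))%:E)%E.
  apply/funext => z; rewrite /bayes_prob/= /bayes setIT.
  have [c c0 ->] := bayes_evidence z.
  by rewrite inver gt_eqF// powR_inv1// ltW.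
apply: emeasurable_funM; first exact: measurable_numerator.
apply/measurable_EFinP; apply: (measurableT_comp (measurable_powR (-1))).
by apply: measurableT_comp => //; exact: measurable_numerator.
Qed.

(** The mean is a difference of integrals of nonnegative functions against the
    kernel, each of which is measurable in the data. *)
Lemma measurable_bayes_mean (g : Y -> R) : measurable_fun setT g ->
  measurable_fun setT (fun z => fine (\int[bayes z]_t (g t)%:E)).
Proof.
move=> mg; apply: measurableT_comp => //.
have -> : (fun z => \int[bayes z]_t (g t)%:E)%E = (fun z =>
    \int[bayes_prob z]_t (EFin \o g)^\+ t - \int[bayes_prob z]_t (EFin \o g)^\- t)%E.
  by apply/funext => z; rewrite integralE.
have mg' : measurable_fun setT (EFin \o g) by exact/measurable_EFinP.
apply: emeasurable_funB; apply: measurable_fun_integral_kernel => //.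
- exact: measurable_bayes_prob.
- exact: measurable_funepos.
- exact: measurable_bayes_prob.
- exact: measurable_funeneg.
Qed.

End bayes.

(** * Measurability of the data and of the likelihood *)

Lemma measurable_observe {R : realType} (d : nat) (H : completeNormedModType R)
    (X : set (d.-tuple R)) (G : H -> d.-tuple R -> R) (theta : H)
    disp (Omega : measurableType disp) (N : nat)
    (x : 'I_N -> Omega -> d.-tuple R) (e : 'I_N -> Omega -> R) :
  measurable X -> measurable_fun X (G theta) ->
  (forall i, measurable_fun setT (x i)) ->
  (forall i, measurable_fun setT (e i)) ->
  measurable_fun setT (observe X G theta x e : Omega -> data R d N).
Proof.
move=> mX mG mx me; apply/measurable_fun_tnthP => i.
rewrite (_ : _ \o _ =
    (fun w => (x i w, regfun X G theta (x i w) + e i w))); last first.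
  by apply/funext => w /=; rewrite tnth_mktuple.
apply: measurable_fun_pair => //; apply: measurable_funD => //.
by apply: measurableT_comp => //; exact/(measurable_restrictT _ mX).
Qed.

Section likelihood.
Context {R : realType} {d : nat} {H : completeNormedModType R}.
Variables (X : set (d.-tuple R)) (G : H -> d.-tuple R -> R) (sigma0 : R).

Lemma likelihood_gt0_le1 (N : nat) (z : data R d N) (t : H) :
  0 < likelihood X G sigma0 z t <= 1.
Proof.
rewrite expR_gt0/= -expR0 ler_expR mulNr oppr_le0 mulr_ge0//.
  by rewrite invr_ge0 mulr_ge0// sqr_ge0.
by apply: sumr_ge0 => i _; rewrite sqr_ge0.
Qed.

(** Joint measurability of (t, y) |-> G t y is given on E x X. Outside X the
    regression function is 0, which extends it to all y, for t in E. *)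
Lemma measurable_likelihood (E : set (borel H)) (N : nat) :
  measurable X -> measurable E ->
  measurable_fun (E `*` X) (fun p : borel H * d.-tuple R => G p.1 p.2) ->
  measurable_fun ([set: data R d N] `*` E)
    (fun p : data R d N * borel H => likelihood X G sigma0 p.1 p.2).
Proof.
move=> mX mE mG.
have mreg : measurable_fun (E `*` [set: d.-tuple R])
    (fun q : borel H * d.-tuple R => regfun X G q.1 q.2).
  have mTX : measurable ([set: borel H] `*` X) by exact: measurableX.
  have mET : measurable (E `*` [set: d.-tuple R]) by exact: measurableX.
  have := (measurable_restrict (fun q : borel H * d.-tuple R => G q.1 q.2) mTX mET).1.
  rewrite (_ : _ `&` _ = E `*` X); last first.
    by apply/seteqP; split=> -[t y] /= [] => [[? _] [_ ?]|? ?].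
  move=> /(_ mG); apply: eq_measurable_fun => -[t y] _; rewrite /regfun !patchE/=.
  congr (if _ then _ else _); apply/idP/idP => /set_mem h; apply/mem_set => //.
  by case: h.
have mD : measurable ([set: data R d N] `*` E) by exact: measurableX.
apply: measurableT_comp => //; apply: measurable_funM => //.
apply: measurable_sum => i; apply: measurable_funX.
have mtn : measurable_fun [set: data R d N * borel H]
    (fun p : data R d N * borel H => tnth p.1 i).
  exact: (measurableT_comp (measurable_tnth i) measurable_fst).
apply: measurable_funB.
  exact: measurable_funTS (measurableT_comp measurable_snd mtn).
have mpair : measurable_fun ([set: data R d N] `*` E)
    (fun p : data R d N * borel H => (p.2, (tnth p.1 i).1)).
  apply: measurable_funTS; apply: measurable_fun_pair => //.
  exact: measurableT_comp measurable_fst mtn.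
apply: (measurable_comp _ _ mreg mpair); first exact: measurableX.
by move=> _ [[z t] [_ Et] <-].
Qed.

End likelihood.

(** * Frequentist coverage of the credible intervals *)

Unset Implicit Arguments.
Set Strict Implicit.
Set Printing Implicit Defensive.

Theorem theorem1p4 (R : realType)
  (* design space *)
  (d : nat) (X : set (d.-tuple R)) (mX : measurable X)
  (X_gt0 : (0 < lebesgue_tuple X)%E) (X_fin : (lebesgue_tuple X < +oo)%E)
  (* separable Hilbert space, dense parameter space, regression functions *)
  (H : completeNormedModType R) (ip : {dot H for idfun})
  (ip_norm : induces_norm ip) (H_sep : separable_space H)
  (Theta : set H) (Theta_lin : linear_subspace Theta) (Theta_dense : dense Theta)
  (G : H -> d.-tuple R -> R)
  (mG : forall t, Theta t -> measurable_fun X (G t))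
  (sigma0 : R) (sigma0_gt0 : 0 < sigma0)
  (* ground truth, and the variables that generate the data *)
  (theta0 : H) (Theta_theta0 : Theta theta0)
  (disp : nat -> measure_display) (Omega : forall N, measurableType (disp N))
  (P : forall N, probability (Omega N) R)
  (x : forall N, 'I_N -> Omega N -> d.-tuple R)
  (e : forall N, 'I_N -> Omega N -> R)
  (mx : forall N i, measurable_fun [set: Omega N] (x N i))
  (me : forall N i, measurable_fun [set: Omega N] (e N i))
  (x_law : forall N i A, measurable A ->
    pushforward (P N) (x N i) A = uniform_law X A)
  (e_law : forall N i A, measurable A ->
    pushforward (P N) (e N i) A = normal_prob 0 sigma0 A)
  (indep : forall N, all_independent (P N) (x N) (e N))
  (* functional *)
  (psi : H) (psi_neq0 : psi != 0)
  (* Gaussian prior on E N, of dimension D N *)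
  (D : nat -> nat) (E : nat -> set H)
  (E_dim : forall N, subspace_of_dim (D N) (E N))
  (E_Theta : forall N, E N `<=` Theta)
  (mG_E : forall N, measurable_fun ((E N : set (borel H)) `*` X)
    (fun p : borel H * d.-tuple R => G p.1 p.2))
  (Pi : forall N, probability (borel H) R)
  (Pi_gauss : forall N, gaussian_measure ip (Pi N))
  (Pi_E : forall N, Pi N (E N) = 1%E)
  (alpha : R) (alpha01 : 0 < alpha < 1)
  (rad : forall N, data R d N -> R)
  (mrad : forall N, measurable_fun [set: data R d N] (rad N)) :
  let law N : set (data R d N) -> \bar R :=
    pushforward (P N) (observe X G theta0 (x N) (e N)) in
  let post N (z : data R d N) : set R -> \bar R :=
    posterior_Psi X G sigma0 (E N) (Pi N) ip psi z in
  let hatPsi N (z : data R d N) : R :=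
    posterior_mean X G sigma0 (E N) (Pi N) ip psi z in
  let I N (z : data R d N) : set R :=
    [set` `[hatPsi N z - rad N z, hatPsi N z + rad N z]] in
  (forall N, {ae law N, forall z, post N z (I N z) = (1 - alpha)%:E}) ->
  (exists sigma : nat -> R,
    [/\ forall N, 0 < sigma N,
        weak_cvg
          (fun N => pushforward (law N)
            (fun z => (sigma N)^-1 * (hatPsi N z - Psi ip psi theta0)))
          (normal_prob 0 1)
      & cvg_in_prob0 law
          (fun N z => d_BL
            (pushforward (post N z) (fun r : R => (sigma N)^-1 * (r - hatPsi N z)))
            (normal_prob 0 1))]) ->
  (fun N => law N [set z | I N z (Psi ip psi theta0)]) @ \oo
    --> (1 - alpha)%:E.
Proof.
move=> law post hatPsi I aepost [sigma [sigma_gt0 cvg_mean cvg_post]].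
have mE N : measurable (E N : set (borel H)).
  exact: measurable_subspace ip_norm (E_dim N).
have mPsi : measurable_fun [set: borel H] (Psi ip psi).
  by apply: continuous_measurable_borel; exact: continuous_ip.
have mobs N : measurable_fun setT (observe X G theta0 (x N) (e N)).
  by apply: measurable_observe => //; exact: mG.
have mlik N := measurable_likelihood sigma0 (N := N) mX (mE N) (mG_E N).
have lik01 N := @likelihood_gt0_le1 R d H X G sigma0 N.
pose Q N : probability (data R d N) R := image_prob (P N) (mobs N).
pose posterior_prob N z : probability (borel H) R :=
  bayes_prob (mE N) (Pi_E N) (mlik N) (lik01 N) z.
have mhat N : measurable_fun setT (hatPsi N).
  exact: (measurable_bayes_mean (mE N) (Pi_E N) (mlik N) (lik01 N) mPsi).
have maff N z : measurable_fun [set: R] (fun r : R => (sigma N)^-1 * (r - hatPsi N z)).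
  by apply: measurable_funM => //; exact: measurable_funB.
pose mu N z : probability R R :=
  image_prob (image_prob (posterior_prob N z) mPsi) (maff N z).
pose S N z : R := (sigma N)^-1 * (hatPsi N z - Psi ip psi theta0).
pose rho N z : R := (sigma N)^-1 * rad N z.
(* Used twice: for the points r of the interval around hatPsi, and with
   r = hatPsi around the true value. *)
have rescale N (r h c : R) :
    (`|(sigma N)^-1 * (r - h)| <= (sigma N)^-1 * c) = (h - c <= r <= h + c).
  rewrite normrM gtr0_norm ?invr_gt0// ler_pM2l ?invr_gt0//.
  rewrite ler_norml.
  by apply/idP/idP => /andP[lo hi]; apply/andP; split; lra.
have post_interval N z : mu N z `[- rho N z, rho N z]%classic = post N z (I N z).
  rewrite -[LHS]/(post N z (_ @^-1` _)); congr (post N z _).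
  by apply/seteqP; split=> r; rewrite /I /= !in_itv/= -ler_norml rescale.
have covered N : [set z | I N z (Psi ip psi theta0)] =
    [set z | `|S N z| <= rho N z].
  apply/seteqP; split=> z; rewrite /I /= in_itv/= rescale => /andP[h1 h2];
    by apply/andP; split; lra.
rewrite (_ : (fun N => _) = (fun N => Q N [set z | `|S N z| <= rho N z])); last first.
  by apply/funext => N; rewrite covered.
apply: (@coverage_of_intervals R _ _ Q S rho mu).
- by lra.
- move=> N; apply: measurable_funM => //.
  by apply: measurable_funB => //; exact: mhat.
- by move=> N; apply: measurable_funM => //; exact: mrad.
- exact: cvg_mean.
- move=> N.
  have : {ae Q N, forall z, post N z (I N z) = (1 - alpha)%:E} := aepost N.
  by apply: filterS => z; rewrite post_interval.
- exact: cvg_post.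
Qed.
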